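(* Let $n\ge1$ and $X\in\mathfrak B^n$. Then $$h^{\star}(n,X)=0\iff (\mathfrak b^{\iota(2,n)}*X)\boxtimes(\mathfrak b^{\iota(2,n)+1}*X)\boxtimes\cdots\boxtimes(\mathfrak b^{\iota(2,n)+\mathfrak c(n)-1}*X)=I,$$ where $I=[1,0,\dots,0]\in\mathfrak B^n$.
   Context: $\mathfrak B^n=\{0,1\}^n$ is regarded as $\mathbb F_2^n$; vectors are indexed $X=[X_0,\dots,X_{n-1}]$ with indices modulo $n$. For a rule $X\in\mathfrak B^n$, the additive cellular automaton $\mathfrak A(n,X)$ has state set $\mathfrak B^n$ and transition map the linear operator $\hat X$, $(\hat X*s)_i=\bigoplus_{k=0}^{n-1}X_k s_{i+k\bmod n}$. A state $s$ is cyclic if $\hat X^t*s=s$ for some $t\ge1$; the height $h^{\star}(n,X)$ is the maximum over all states $s$ of the least $t\ge0$ such that $\hat X^t*s$ is cyclic (so it is $0$ iff all states are cyclic). The associative operation $\boxtimes$ on $\mathfrak B^n$ is $(L\boxtimes M)_j=\bigoplus_{k=0}^{n-1}L_kM_{j-k\bmod n}$. The discrete baker transformation $\mathfrak b:\mathfrak B^n\to\mathfrak B^n$ is defined by $(\mathfrak b*X)_i=\bigoplus_{j\in\{0,\dots,n-1\}:\ 2j\equiv i\ (\mathrm{mod}\ n)}X_j$ (an empty sum being $0$); $\mathfrak b^k$ is its $k$-fold iterate, $\mathfrak b^0$ the identity. $\iota(2,n)$ is the exponent of the largest power of $2$ dividing $n$. Put $n'=n/2^{\iota(2,n)}$; then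 $\mathfrak c(n)=\mathrm{ord}_{n'}2$ (the least positive integer $x$ with $2^x\equiv1\ (\mathrm{mod}\ n')$) if $n'>1$, and $\mathfrak c(n)=1$ if $n'=1$. *)

(* Defs.v *)
From HB Require Import structures.
From mathcomp Require Import all_boot all_order all_algebra.
From mathcomp Require Import cyclic.

Set Implicit Arguments.
Unset Strict Implicit.
Unset Printing Implicit Defensive.

Import GRing.Theory.
Local Open Scope ring_scope.

Section FiniteDynamics.
Variables (T : finType) (f : T -> T).

Definition cyclic_state (s : T) : Prop :=
  exists t : nat, (1 <= t)%N /\ iter t f s = s.

Definition cyclic_stateb (s : T) : bool := fconnect f (f s) s.

Lemma cyclic_stateP s : reflect (cyclic_state s) (cyclic_stateb s).
Proof.
apply: (iffP idP) => [/iter_findex e | [[|t] [//_ e]]].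
  by exists (findex f (f s) s).+1; rewrite iterSr.
by rewrite /cyclic_stateb -{2}e iterSr fconnect_iter.
Qed.

Lemma ex_cyclic_iter s : exists t, cyclic_stateb (iter t f s).
Proof.
have /trajectP[i lt_i e] := looping_order f s.
exists i; apply/cyclic_stateP; exists (fingraph.order f s - i)%N.
by rewrite subn_gt0 lt_i -iterD subnK ?e // ltnW.
Qed.

Definition transient_time (s : T) : nat := ex_minn (ex_cyclic_iter s).

End FiniteDynamics.

(* The residue of m modulo n as an element of 'I_n; the argument i only
   witnesses that n > 0. *)
Definition modord (n : nat) (i : 'I_n) (m : nat) : 'I_n :=
  Ordinal (ltn_pmod m (leq_ltn_trans (leq0n i) (ltn_ord i))).

Definition ca_step (n : nat) (X s : 'rV['F_2]_n) : 'rV['F_2]_n :=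
  \row_(i < n) \sum_(k < n) X 0 k * s 0 (modord i (i + k)).

Definition height (n : nat) (X : 'rV['F_2]_n) : nat :=
  (\max_(s : 'rV['F_2]_n) transient_time (ca_step X) s)%N.

(* Since k < n, the natural number j + (n - k) represents j - k modulo n. *)
Definition boxtimes (n : nat) (L M : 'rV['F_2]_n) : 'rV['F_2]_n :=
  \row_(j < n) \sum_(k < n) L 0 k * M 0 (modord j (j + (n - k))).

Definition box_id (n : nat) : 'rV['F_2]_n := \row_(i < n) (i == 0%N :> nat)%:R.

Lemma boxtimesE n (L M : 'rV['F_2]_n.+1) j :
  boxtimes L M 0 j = \sum_k L 0 k * M 0 (j - k).
Proof.
rewrite mxE; apply: eq_bigr => k _; congr (_ * M 0 _).
by apply: val_inj; rewrite /= modnDmr.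
Qed.

Lemma boxtimesC n : commutative (@boxtimes n).
Proof.
case: n => [|n] L M; first by apply/rowP => -[].
apply/rowP => j; rewrite !boxtimesE.
rewrite (reindex_inj (subrI j)) /=; apply: eq_bigr => k _.
by rewrite subKr mulrC.
Qed.

Lemma boxtimesA n : associative (@boxtimes n).
Proof.
case: n => [|n] L M N; first by apply/rowP => -[].
apply/rowP => j; rewrite !boxtimesE.
under eq_bigr do rewrite boxtimesE mulr_sumr.
under [RHS]eq_bigr do rewrite boxtimesE mulr_suml.
rewrite [RHS]exchange_big; apply: eq_bigr => k _ /=.
rewrite [RHS](reindex_inj (addrI k)) /=; apply: eq_bigr => l _.
by rewrite mulrA [k + l - k]addrC addKr opprD addrA.
Qed.

Lemma box1times n : left_id (box_id n) (@boxtimes n).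
Proof.
case: n => [|n] L; first by apply/rowP => -[].
apply/rowP => j; rewrite boxtimesE (bigD1 0) //= big1 => [|k k0].
  by rewrite mxE /= mul1r subr0 addr0.
by rewrite mxE -[_ == _]/(k == 0) (negPf k0) mul0r.
Qed.

HB.instance Definition _ (n : nat) :=
  Monoid.isComLaw.Build 'rV['F_2]_n (box_id n) (@boxtimes n)
    (@boxtimesA n) (@boxtimesC n) (@box1times n).

Definition baker (n : nat) (X : 'rV['F_2]_n) : 'rV['F_2]_n :=
  \row_(i < n) \sum_(j < n | 2 * j == i %[mod n]) X 0 j.

Lemma ex_mulord (a m : nat) :
  exists x, ((0 < x) && (coprime a m ==> (a ^ x == 1 %[mod m])))%N.
Proof.
have [co_am | _] := boolP (coprime a m); last by exists 1%N.
case: m co_am => [|m] co_am.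
  by exists 1%N; move: co_am; rewrite /coprime gcdn0 => /eqP->.
by exists (totient m.+1); rewrite totient_gt0 Euler_exp_totient //= eqxx.
Qed.

(* The multiplicative order of a modulo m, with value 1 if a is not
   invertible modulo m. *)
Definition mulord (a m : nat) : nat := ex_minn (ex_mulord a m).

Definition cc (n : nat) : nat :=
  let n' := (n %/ 2 ^ logn 2 n)%N in if (1 < n')%N then mulord 2 n' else 1%N.

(* Main.v *)
Require Import Defs.
From mathcomp Require Import all_boot all_order all_algebra.

(** Identify a rule with an element of [F_2[x] / (x^n - 1)], so that [boxtimes]
    is the product. Up to the reflection [i |-> - i], [ca_step X] is
    multiplication by [X]; hence all states are cyclic iff [X] is invertible.
    In characteristic 2 the baker map [b] is squaring, so with
    [m = logn 2 n] the product [P] of the theorem satisfies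
    [b^m X * P = b^(m + cc n) X]; and [b^(m + cc n) X = b^m X], because
    [2^(m + cc n) = 2^m] modulo [n]. If [X] is invertible, so is [b^m X],
    and [P = 1]. Conversely [P] is a multiple of [X]. *)

Set Implicit Arguments.
Unset Strict Implicit.
Unset Printing Implicit Defensive.

Import GRing.Theory.
Local Open Scope ring_scope.

(** Points moved by [s] come in pairs [k], [s k] with equal terms, which cancel in characteristic
    2. *)
Lemma sum_involution_F2 (T : finType) (s : T -> T) (F : T -> 'F_2) :
  involutive s -> (forall k, F (s k) = F k) ->
  \sum_k F k = \sum_(k | s k == k) F k.
Proof.
move=> sK Fs; rewrite (bigID (fun k => s k == k)) /=.
rewrite [X in _ + X](_ : _ = 0) ?addr0 //.
(* Comparing ranks selects one point of each pair; reindexing by [s] carries one half onto the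
   other. *)
rewrite (bigID (fun k => (enum_rank (s k) < enum_rank k)%N)) /=.
rewrite [X in _ + X](reindex_inj (inv_inj sK)) /=.
rewrite [X in _ + X](eq_big
  (fun k => (s k != k) && (enum_rank (s k) < enum_rank k)%N) F) => [|k|k _].
- by rewrite -mulr2n -mulr_natr (_ : 2%:R = 0 :> 'F_2) ?mulr0 //; apply: val_inj.
- rewrite sK eq_sym -leqNgt leq_eqVlt val_eqE (inj_eq enum_rank_inj).
  by case: (s k == k).
- exact: Fs.
Qed.

(** The terms [X_k * X_(i-k)] of the square are invariant under [k -> i - k]. The fixed points are
    the [k] with [2k = i], and there [X_k * X_k = X_k] in [F_2]. *)
Lemma baker_square (n : nat) (X : 'rV['F_2]_n.+1) : baker X = boxtimes X X.
Proof.
apply/rowP => i; rewrite boxtimesE.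
rewrite (@sum_involution_F2 _ (fun k => i - k)) => [||k].
- rewrite mxE; apply: eq_big => [j|j /eqP e].
    rewrite subr_eq -[RHS]val_eqE /= mul2n -addnn eq_sym.
    by rewrite (modn_small (ltn_ord i)).
  have -> : i - j = j.
    apply/eqP; rewrite subr_eq -val_eqE /= -{1}(modn_small (ltn_ord i)) -e.
    by rewrite mul2n -addnn.
  by case: (X 0 j) => [[|[|//]] H]; apply: val_inj.
- by move=> k; rewrite subKr.
- by rewrite subKr mulrC.
Qed.

Lemma iter_bakerE (n : nat) (X : 'rV['F_2]_n) (k : nat) (i : 'I_n) :
  iter k (@baker n) X 0 i = \sum_(j < n | 2 ^ k * j == i %[mod n]) X 0 j.
Proof.
elim: k i => [|k IHk] i.
  rewrite (big_pred1 i) // => j.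
  by rewrite mul1n !modn_small.
rewrite iterS mxE.
(* Group the [j] by the residue [l] of [2 ^ k * j]; the last [baker] sums over these [l]. *)
rewrite [RHS](partition_big (fun j : 'I_n => modord j (2 ^ k * j))
               (fun l : 'I_n => 2 * l == i %[mod n])) /=; last first.
  by move=> j; rewrite modnMmr mulnA -expnS.
apply: eq_bigr => l /eqP el; rewrite IHk; apply: eq_bigl => j.
rewrite -val_eqE /= (modn_small (ltn_ord l)).
case: eqP => [e|]; last by rewrite andbF.
by rewrite expnS -mulnA -modnMmr e el eqxx.
Qed.

Lemma expn_mulord (a m : nat) : coprime a m -> a ^ mulord a m = 1 %[mod m].
Proof.
by move=> co; rewrite /mulord; case: ex_minnP => x /andP[_ /implyP/(_ co)/eqP].
Qed.

Lemma cc_gt0 (n : nat) : (0 < cc n)%N.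
Proof.
by rewrite /cc; case: ifP => // _; rewrite /mulord; case: ex_minnP => x /andP[].
Qed.

Lemma expn_logn_cc (n : nat) :
  (0 < n)%N -> 2 ^ (logn 2 n + cc n) = 2 ^ logn 2 n %[mod n].
Proof.
move=> n_gt0; have [q co_q def_n] := pfactor_coprime (isT : prime 2) n_gt0.
have qE : (n %/ 2 ^ logn 2 n = q)%N by rewrite {1}def_n mulnK ?expn_gt0.
have e : 2 ^ cc n = 1 %[mod q].
  rewrite /cc qE; case: ltnP => [_|]; first exact: expn_mulord.
  (* Coprimality with 2 excludes [q = 0], so [q = 1] and the congruence is trivial. *)
  by case: q {def_n qE} co_q => [|[|]] // _ _; rewrite !modn1.
by rewrite expnD {3 5}def_n [(q * _)%N]mulnC -muln_modr e muln_modr muln1.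
Qed.

Lemma iter_baker_periodic (n : nat) (X : 'rV['F_2]_n) :
  iter (logn 2 n + cc n) (@baker n) X = iter (logn 2 n) (@baker n) X.
Proof.
apply/rowP => i; rewrite !iter_bakerE; apply: eq_bigl => j.
have n_gt0 : (0 < n)%N by apply: leq_ltn_trans (ltn_ord i).
by rewrite -modnMml expn_logn_cc // modnMml.
Qed.

(** Inductively, the product so far equals the next factor, so that factor squares it, which is one
    more [baker]. *)
Lemma mul_prod_iter_baker (n : nat) (X : 'rV['F_2]_n.+1) (m c : nat) :
  boxtimes (iter m (@baker _) X)
    (\big[@boxtimes n.+1 / box_id n.+1]_(m <= k < m + c) iter k (@baker _) X)
  = iter (m + c) (@baker _) X.
Proof.
elim: c => [|c IHc]; first by rewrite addn0 big_geq // Monoid.mulm1.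
by rewrite addnS big_nat_recr ?leq_addr //= boxtimesA IHc -baker_square.
Qed.

Lemma iter_baker_multiple (n : nat) (X : 'rV['F_2]_n.+1) (k : nat) :
  exists Y, iter k (@baker _) X = boxtimes X Y.
Proof.
elim: k => [|k [Y e]]; first by exists (box_id _); rewrite Monoid.mulm1.
by exists (boxtimes Y (boxtimes X Y)); rewrite iterS baker_square e -boxtimesA.
Qed.

Lemma iter_baker_inv (n : nat) (X Y : 'rV['F_2]_n.+1) (k : nat) :
  boxtimes X Y = box_id _ ->
  boxtimes (iter k (@baker _) X) (iter k (@baker _) Y) = box_id _.
Proof.
move=> XY1; elim: k => [//|k IHk].
by rewrite !iterS !baker_square Monoid.mulmACA /= IHk box1times.
Qed.

(** [ca_step] reads the state at [i + k], [boxtimes] at [i - k]; negating indices exchanges the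
    two. *)
Definition reflect_row (n : nat) (s : 'rV['F_2]_n.+1) : 'rV['F_2]_n.+1 :=
  \row_i s 0 (- i).

Lemma reflect_rowK (n : nat) : involutive (@reflect_row n).
Proof. by move=> s; apply/rowP => i; rewrite !mxE opprK. Qed.

Lemma reflect_box_id (n : nat) : reflect_row (box_id n.+1) = box_id n.+1.
Proof.
by apply/rowP => i; rewrite !mxE -[_ == _]/(- i == 0) oppr_eq0.
Qed.

Lemma reflect_ca_step (n : nat) (X s : 'rV['F_2]_n.+1) :
  reflect_row (ca_step X s) = boxtimes X (reflect_row s).
Proof.
apply/rowP => i; rewrite boxtimesE !mxE; apply: eq_bigr => k _.
rewrite mxE opprB addrC; congr (_ * s 0 _).
by apply: val_inj.
Qed.

Lemma transient_time_eq0 (T : finType) (f : T -> T) (s : T) :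
  (transient_time f s == 0%N) = cyclic_stateb f s.
Proof.
rewrite /transient_time; case: ex_minnP => t cyc_t min_t.
by apply/eqP/idP => [t0|/(min_t 0%N)]; [rewrite t0 in cyc_t | rewrite leqn0 => /eqP].
Qed.

Lemma height_eq0P (n : nat) (X : 'rV['F_2]_n) :
  height X = 0%N <-> forall s : 'rV['F_2]_n, cyclic_state (ca_step X) s.
Proof.
split=> [h0 s | cyc].
  apply/cyclic_stateP; rewrite -transient_time_eq0 -leqn0.
  have : (transient_time (ca_step X) s <= height X)%N by apply: (leq_bigmax s).
  by rewrite h0.
apply/eqP; rewrite -leqn0; apply/bigmax_leqP => s _.
by rewrite leqn0 transient_time_eq0; apply/cyclic_stateP.
Qed.

Lemma height_eq0_invertible (n : nat) (X : 'rV['F_2]_n.+1) :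
  height X = 0%N <-> exists Y, boxtimes X Y = box_id _.
Proof.
apply: (iff_trans (height_eq0P X)); split=> [/(_ (box_id _)) [[|t] [//_ e]] | [Y XY1] s].
  (* The unit returns after [t + 1] steps, so [X^(t+1) = 1]; the witness is [X^t]. *)
  exists (reflect_row (iter t (ca_step X) (box_id _))).
  by rewrite -reflect_ca_step -iterS e reflect_box_id.
(* An injective map of a finite set is a permutation, so every state lies on a cycle. *)
have inj_step : injective (ca_step X).
  move=> s1 s2 /(congr1 (boxtimes Y \o @reflect_row n)) /=.
  rewrite !reflect_ca_step !boxtimesA (boxtimesC Y) XY1 !box1times.
  exact: (inv_inj (@reflect_rowK n)).
by apply/cyclic_stateP; rewrite /cyclic_stateb fconnect_sym // fconnect1.
Qed.

Theorem theorem11 (n : nat) (hn : (1 <= n)%N) (X : 'rV['F_2]_n) :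
  height X = 0%N <->
  \big[@boxtimes n / box_id n]_(logn 2 n <= k < logn 2 n + cc n)
     iter k (@baker n) X = box_id n.
Proof.
case: n hn X => [//|n] _ X; apply: (iff_trans (height_eq0_invertible X)).
split=> [[Y XY1] | P1].
  have := mul_prod_iter_baker X (logn 2 n.+1) (cc n.+1).
  rewrite iter_baker_periodic.
  (* The iterate of [Y] is inverse to that of [X], so it cancels on both sides. *)
  move/(congr1 (boxtimes (iter (logn 2 n.+1) (@baker _) Y))).
  by rewrite boxtimesA !(boxtimesC (iter _ _ Y)) iter_baker_inv // box1times.
(* As [cc] is positive, the product has a first factor, and this is a multiple of [X]. *)
have [Y e] := iter_baker_multiple X (logn 2 n.+1).
move: P1; rewrite big_ltn; last by rewrite -addn1 leq_add2l cc_gt0.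
by rewrite e -boxtimesA => P1; eexists; exact: P1.
Qed.
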